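(* Let $G\in\mathcal{P}$. Then for every Hamilton bond of $G$, the two end-trees of the bond contain the same number of vertices of degree 6 in $G$ and the same number of vertices of degree 3 in $G$.
   Context: Graphs are finite and loopless but may have multiple edges. A plane triangulation is a plane graph all of whose faces (including the outer one) are bounded by cycles of length 3. $\mathcal{P}$ is the family of all 2-connected plane triangulations all of whose vertices have degree 3 or 6. A bond of a connected graph $G$ is a minimal non-empty edge cut. A Hamilton bond of $G$ is a bond $B$ such that both components of $G\setminus B$ ($G$ with the edges of $B$ deleted) are trees; these two trees are called the end-trees of the bond. *)

(* Defs.v *)
From HB Require Import structures.
From mathcomp Require Import all_boot perm.

Set Implicit Arguments.
Unset Strict Implicit.
Unset Printing Implicit Defensive.

(* Finite loopless graphs with multiple edges.  Each edge comes with an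
   arbitrary orientation, which only serves to name its two half-edges: all
   graph notions below are insensitive to it. *)
Record multigraph := Multigraph {
  vertex : finType;
  edge : finType;
  etail : edge -> vertex;
  ehead : edge -> vertex;
  loopless : forall e, etail e != ehead e
}.

Section Graph.

Variable G : multigraph.
Implicit Types (A T X : {set vertex G}) (F B : {set edge G}).

Definition ends (e : edge G) : {set vertex G} := [set etail e; ehead e].

Definition degree (v : vertex G) : nat := #|[set e | v \in ends e]|.

(* (e, false) is e traversed from tail to head, (e, true) is its reverse. *)
Definition dart : finType := (edge G * bool)%type.

Definition source (d : dart) : vertex G := if d.2 then ehead d.1 else etail d.1.

Definition rev_dart (d : dart) : dart := (d.1, ~~ d.2).

Definition target (d : dart) : vertex G := source (rev_dart d).

(* The condition on edges excludes traversing one edge back and forth; two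
   parallel edges do form a cycle (of length 2). *)
Definition is_cycle (p : seq dart) : bool :=
  [&& p != [::], cycle [rel x y | target x == source y] p,
      uniq (map source p) & uniq [seq d.1 | d <- p]].

(* In what follows (A, F) stands for the subgraph of G with vertex set A whose
   edges are the edges in F having both ends in A. *)
Definition adjacent A F : rel (vertex G) :=
  [rel u v | [exists e in F, (ends e \subset A) && (ends e == [set u; v])]].

Definition connected A F : Prop :=
  A != set0 /\ {in A &, forall u v, connect (adjacent A F) u v}.

Definition acyclic A F : Prop :=
  forall p, is_cycle p -> ~~ all (fun d => (d.1 \in F) && (ends d.1 \subset A)) p.

Definition is_tree A F : Prop := connected A F /\ acyclic A F.

Definition k_connected (k : nat) : Prop :=
  k < #|vertex G| /\ forall X, #|X| < k -> connected (~: X) setT.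

(* Vertex sets of the components of the spanning subgraph with edge set F. *)
Definition components F : {set {set vertex G}} :=
  equivalence_partition (connect (adjacent setT F)) setT.

Definition boundary X : {set edge G} :=
  [set e | (etail e \in X) != (ehead e \in X)].

Definition is_edge_cut B : bool := [exists X, B == boundary X].

Definition is_bond B : bool :=
  minset (fun C : {set edge G} => (C != set0) && is_edge_cut C) B.

Definition hamilton_bond B : Prop :=
  is_bond B /\ {in components (~: B), forall T, is_tree T (~: B)}.

(* T1 and T2 are the two components of G \ B. *)
Definition end_trees B T1 T2 : Prop :=
  [/\ T1 \in components (~: B), T2 \in components (~: B) & T1 != T2].

(* The next dart on the boundary walk of a face, for a rotation system r. *)
Definition next_on_face (r : {perm dart}) (d : dart) : dart := r (rev_dart d).

End Graph.

(* A plane graph is given as a combinatorial map: rotation sends a dart to the next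
   one in the cyclic order around its source, and the faces (the outer one
   included) are the orbits of next_on_face rotation.  Such a map on a connected
   graph embeds in the sphere exactly when its Euler characteristic is 2.
   Only connected graphs with at least one edge are covered (for a single
   vertex without edges, fcard counts 0 faces); this is no restriction for
   graphs all of whose faces are bounded by cycles. *)
Record plane_graph := PlaneGraph {
  graph :> multigraph;
  rotation : {perm dart graph};
  rotation_orbit : forall d d' : dart graph,
    fconnect rotation d d' = (source d == source d');
  plane_connected : connected [set: vertex graph] [set: edge graph];
  plane_euler :
    #|vertex graph| + fcard (next_on_face rotation) predT = #|edge graph| + 2
}.

Definition face (G : plane_graph) : dart G -> dart G := next_on_face (rotation G).

(* orbit (@face G) d is the boundary walk of the face to which d belongs. *)
Definition triangulation (G : plane_graph) : Prop :=
  forall d : dart G,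
    is_cycle (orbit (@face G) d) /\ size (orbit (@face G) d) = 3.

Definition in_P (G : plane_graph) : Prop :=
  [/\ k_connected G 2, triangulation G
    & forall v : vertex G, degree v = 3 \/ degree v = 6].

(* Main.v *)
(* Deleting B leaves two induced trees T1 and T2 with B as common boundary.  No
   facial triangle lies inside a tree, so each one meets B in exactly two of its
   edges; thus 3|B| = 2|E|.  The degree sum of a tree T_i is
   2(|T_i| - 1) + |B|, so that a_i + 4 b_i = |B| - 2, where a_i and b_i count the
   vertices of degree 3 and 6 in T_i (this is Grinberg's identity).  Euler's
   formula gives a_1 + a_2 = 4, hence a_1 - a_2 is 0, 4 or -4, and only the parity
   of |E| is missing: if |E| is even then a_i = 2 (mod 4), so a_1 = a_2 = 2.

   The parity comes from the monodromy group of the map.  The rotation r, the dart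
   reversal a and their product satisfy r^6 = a^2 = (a r)^3 = 1, the relations of
   the group of rotations of the triangular lattice.  Its translations form an
   abelian normal subgroup A, and r^3, which fixes the darts d0 at a vertex of
   degree 3, inverts A.  A fundamental translation which acts on d0 as the square
   of some element of A would make a conjugate of a, a half-turn about the midpoint
   of an edge, fix a dart; but a has no fixed point.  So the stabiliser of d0 in A
   together with the squares misses all three fundamental translations and has
   index 4 in A.  Therefore 4 divides the number 2|E| of darts. *)

Require Import Defs.
From HB Require Import structures.
From mathcomp Require Import all_boot perm.
From mathcomp Require Import all_fingroup all_solvable zify.

Set Implicit Arguments.
Unset Strict Implicit.
Unset Printing Implicit Defensive.

(** * Translations in finite quotients of the triangular rotation group *)

Section TriangleGroup.
Import GroupScope.

(** [A / S] is an elementary abelian 2-group, so its order is a power of 2. It exceeds 2 because 1,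
    [t] and [u] lie in distinct cosets: if [t] and [u] shared one, [t * u] would be a square modulo
    [S]. *)
Lemma dvdn4_index (gT : finGroupType) (A S : {group gT}) (t u : gT) :
    abelian A -> S \subset A -> {in A, forall z, z ^+ 2 \in S} ->
    t \in A -> u \in A -> t \notin S -> u \notin S -> t * u \notin S ->
  4 %| #|A : S|.
Proof.
move=> abA sSA sqS tA uA tS uS tuS.
have nSA : A \subset 'N(S) by exact: sub_abelian_norm.
have abelQ : 2.-abelem (A / S).
  rewrite abelemE // quotient_abelian //=.
  apply/exponentP => _ /morphimP[z zN zA ->].
  by rewrite -morphX //= coset_id // sqS.
rewrite -card_quotient //.
have [k Ek] := p_natP (abelem_pgroup abelQ).
have : 2 < #|A / S|.
  have tN := subsetP nSA _ tA; have uN := subsetP nSA _ uA.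
  have out z : z \in 'N(S) -> (coset S z == 1) = (z \in S).
    move=> zN; apply/eqP/idP => [|zS]; last exact: coset_id.
    exact: coset_idr.
  have sub : [set 1; coset S t; coset S u] \subset A / S.
    by rewrite !subUset !sub1set group1 !mem_quotient.
  apply: leq_trans (subset_leq_card sub).
  rewrite -setUA !cardsU1 cards1 !inE ![1 == _]eq_sym !out // (negPf tS) (negPf uS).
  rewrite (_ : _ == _ = false) //; apply/negP => /eqP etu.
  have := out (t * u); rewrite groupM // (negPf tuS) morphM //= etu => /(_ isT).
  by rewrite -expg2 -morphX //= coset_id ?eqxx // sqS.
by rewrite Ek; case: k {Ek} => [|[|k]] // _; rewrite !expnS mulnA dvdn_mulr.
Qed.

Variables (gT : finGroupType) (r a : gT).
Hypotheses (r6 : r ^+ 6 = 1) (a2 : a ^+ 2 = 1) (ar3 : (a * r) ^+ 3 = 1).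

(* In the triangular lattice, a * r ^+ 3 is the composite of the half-turns about
   the midpoint and the source of a dart. *)
Definition translation k := (a * r ^+ 3) ^ (r ^+ k).
Local Notation tau := translation.

(** Two generators suffice: [tau 1] is their product, and [tau (3 + k)] inverts [tau k]. *)
Definition translations := (<[tau 0]> <*> <[tau 2]>)%G.
Local Notation A := translations.

Lemma mul_r3_r3 : r ^+ 3 * r ^+ 3 = 1.
Proof. by rewrite -expgD. Qed.

Lemma mul_aa : a * a = 1.
Proof. by rewrite -expg2. Qed.

Lemma translationJ k m : tau k ^ (r ^+ m) = tau (k + m).
Proof. by rewrite -conjgM -expgD. Qed.

Lemma translation_add3 k : tau (3 + k) = (tau k)^-1.
Proof.
rewrite -translationJ /tau -conjVg; congr (_ ^ _).
apply/eqP; rewrite eq_sym eq_invg_mul conjgE.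
move: (r ^+ 3) mul_r3_r3 => s ss.
by rewrite !mulgA mulgK -(mulgA _ s s) ss mulg1 mul_aa.
Qed.

(** Write [a * r] as [tau 0 * r ^+ 4]. Moving the powers of [r] in its cube to the right turns [ar3]
    into [tau 0 * tau 2 * tau 4 = 1], where [tau 4] is the inverse of [tau 1]. *)
Lemma translation_triangle : tau 0 * tau 2 = tau 1.
Proof.
have r4 : r ^- 2 = r ^+ 4 by apply/eqP; rewrite eq_invg_mul -expgD r6.
have r2 : r ^- 4 = r ^+ 2 by apply/eqP; rewrite eq_invg_mul -expgD r6.
apply: (mulIg (tau 1)^-1); rewrite mulgV -(translation_add3 1) -ar3.
have -> : a * r = a * r ^+ 3 * r ^+ 4.
  by rewrite -mulgA -expgD expgS r6 mulg1.
rewrite /tau !conjgE r4 r2 expg0 invg1 mul1g mulg1.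
move: (a * r ^+ 3) (r ^+ 4) (r ^+ 2) (expgD r 2 2) => t x y ->.
by rewrite !expgS expg0 mulg1 -!mulgA.
Qed.

(** Conjugating the triangle relation by [r] gives [tau 1 * tau 3 = tau 2], that is,
    [tau 1 = tau 2 * tau 0]. *)
Lemma translation_comm : commute (tau 0) (tau 2).
Proof.
rewrite /commute translation_triangle.
have := congr1 (conjg^~ (r ^+ 1)) translation_triangle.
by rewrite conjMg !translationJ (translation_add3 0) => /(canRL (mulgKV _)) /=.
Qed.

Lemma translations_abelian : abelian A.
Proof.
rewrite /= abelianY !cycle_abelian /= cycle_subG.
apply: (subsetP (_ : 'C[tau 0] \subset _)); first by rewrite -cent_cycle.
by apply/cent1P; rewrite /commute translation_comm.
Qed.

Lemma mem_translations k : tau k \in A.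
Proof.
have A0 : tau 0 \in A by rewrite mem_gen // inE cycle_id.
have A2 : tau 2 \in A by rewrite mem_gen // inE cycle_id orbT.
elim/ltn_ind: k => -[_ //|[_|[_ //|k IH]]]; first by rewrite -translation_triangle groupM.
by rewrite (translation_add3 k) groupV; apply: IH; do 2!apply: leqW.
Qed.

Lemma translations_norm_r : r \in 'N(A).
Proof.
have J k : tau k ^ r = tau k.+1 by rewrite -addn1 -translationJ expg1.
rewrite inE /= conjYg -!cycleJ !J join_subG !cycle_subG.
by rewrite !mem_translations.
Qed.

Lemma translations_inv_r3 z : z \in A -> z ^ (r ^+ 3) = z^-1.
Proof.
have /andP[_ cA] : abelian <[tau 0]> && (<[tau 2]> \subset 'C(<[tau 0]>)).
  by have := translations_abelian; rewrite /= abelianY => /and3P[-> _ ->].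
rewrite /= cent_joinEr // => /mulsgP[_ _ /cycleP[i ->] /cycleP[j ->] ->].
have J k : tau k ^ (r ^+ 3) = (tau k)^-1 by rewrite translationJ addnC translation_add3.
rewrite conjMg !conjXg !J !expgVn -invMg; congr (_^-1).
by apply: commuteX2; apply: commute_sym; apply: translation_comm.
Qed.

Lemma flip_translation k : a ^ (r ^+ k) = tau k * r ^+ 3.
Proof.
have cr : r ^+ 3 ^ (r ^+ k) = r ^+ 3.
  by rewrite conjgE -expgD addnC expgD mulKg.
by rewrite -[X in _ = _ * X]cr -conjMg -mulgA mul_r3_r3 mulg1.
Qed.

(** The flip is a translation followed by [r ^+ 3]; the translation centralises [A] and [r ^+ 3]
    inverts it. *)
Lemma translations_inv_flip k z : z \in A -> z ^ (a ^ (r ^+ k)) = z^-1.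
Proof.
move=> zA; rewrite flip_translation conjgM -translations_inv_r3 //; congr (_ ^ _).
by apply/conjg_fixP/commgP; apply: (centsP translations_abelian) => //; apply: mem_translations.
Qed.

Lemma translations_normal : A <| <<[set r; a]>>.
Proof.
have gr : r \in <<[set r; a]>> by rewrite mem_gen // !inE eqxx.
have ga : a \in <<[set r; a]>> by rewrite mem_gen // !inE eqxx orbT.
rewrite /normal; apply/andP; split.
  by rewrite join_subG !cycle_subG /tau !(groupJ, groupM, groupX).
have nr := translations_norm_r.
rewrite gen_subG subUset !sub1set nr /=.
have -> : a = tau 0 * r ^+ 3 by rewrite -flip_translation conjg1.
by rewrite groupM ?groupX // (subsetP (normG A)) // mem_translations.
Qed.

Lemma dvdn4_card_transitive (T : finType) (to : {action gT &-> T}) (x0 : T) :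
    [transitive <<[set r; a]>>, on [set: T] | to] ->
    to x0 (r ^+ 3) = x0 -> (forall x, to x a != x) ->
  4 %| #|T|.
Proof.
move=> trans fix0 nofix.
have cA := centsP translations_abelian.
(* [S] is the product of the stabiliser of [x0] in [A] and the subgroup of squares. *)
pose S := [set z in A | [exists w in A, to x0 z == to x0 (w ^+ 2)]].
have SP z : reflect (z \in A /\ exists2 w, w \in A & to x0 z = to x0 (w ^+ 2)) (z \in S).
  rewrite inE; apply: (iffP andP) => -[zA] => [/exists_inP[w wA /eqP]|[w wA zw]].
    by split=> //; exists w.
  by split=> //; apply/exists_inP; exists w => //; apply/eqP.
have gS : group_set S.
  apply/group_setP; split; first by apply/SP; split=> //; exists 1; rewrite ?expg1n.
  move=> y z /SP[yA [v vA yv]] /SP[zA [w wA zw]]; apply/SP; split; first exact: groupM.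
  exists (v * w); first exact: groupM.
  rewrite actM yv -actM (cA _ (groupX 2 vA) _ zA) actM zw -actM.
  rewrite expgMn; last exact: cA.
  by congr (to _ _); apply: cA; apply: groupX.
have sSA : S \subset A by apply/subsetP=> z /SP[].
(* If [tau k] moved [x0] as [w ^+ 2] does, the flip [a ^ (r ^+ k)] would send [x0] to its image
   under [w ^- 2]. As the flip inverts [w], it would fix the image of [x0] under [w^-1], and so a
   conjugate point would be fixed by [a]. *)
have tS k : tau k \notin S.
  apply/SP => -[tA [w wA tw]].
  have flipE : a ^ (r ^+ k) = r ^+ 3 * (tau k)^-1.
    rewrite flip_translation conjgC; congr (_ * _).
    exact: translations_inv_r3.
  have flip0 : to x0 (a ^ (r ^+ k)) = to x0 (w ^- 2).
    rewrite flipE actM fix0; apply: (act_inj to (w ^+ 2)).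
    by rewrite -!actM mulVg act1 (cA _ (groupVr tA) _ (groupX 2 wA)) actM -tw actK.
  have fixw : to (to x0 w^-1) (a ^ (r ^+ k)) = to x0 w^-1.
    rewrite -actM conjgC translations_inv_flip ?groupV // invgK actM flip0 -actM.
    by rewrite expgS expg1 invMg mulgKV.
  move: fixw (nofix (to (to x0 w^-1) (r ^- k))); rewrite conjgE !actM => fixw /eqP[].
  by apply: (act_inj to (r ^+ k)); rewrite actKV.
have d4 : 4 %| #|A : Group gS|.
  apply: (@dvdn4_index _ _ _ (tau 0) (tau 2));
    rewrite ?translations_abelian ?translation_triangle ?mem_translations ?tS //.
  by move=> z zA; apply/SP; split; [exact: groupX | exists z].
(* With [C] the stabiliser of [x0], the index of [S] in [A] divides that of [A :&: C], which equals
   the index of [C] in [C <*> A] and so divides [#|G : C| = #|T|]. *)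
pose G := <<[set r; a]>>%G; pose C := 'C_G[x0 | to]%G.
have /andP[sAG nAG] : A <| G := translations_normal.
have sCG : C \subset G by apply: subsetIl.
have -> : #|T| = #|G : C|.
  by rewrite -card_orbit -cardsT (atransP trans).
rewrite -(@Lagrange_index _ G (C <*> A)%G C) ?joing_subl //; last by rewrite join_subG sAG andbT.
apply: dvdn_mull; have -> : #|C <*> A : C| = #|A : A :&: C|.
  by rewrite norm_joinEl ?(subset_trans sCG) // indexMg indexgI.
rewrite -(@Lagrange_index _ A (Group gS)) //; first exact: dvdn_mulr.
apply/subsetP=> z /setIP[zA /setIP[_ /astab1P z0]]; apply/SP; split=> //.
by exists 1; rewrite // expg1n act1.
Qed.

End TriangleGroup.

(** * Edge bound for forests *)

Section Forests.

Variable G : multigraph.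
Implicit Types (A C T : {set vertex G}) (F B : {set edge G}) (e : edge G) (d : dart G).

Lemma in_ends e x : (x \in ends e) = (x == etail e) || (x == ehead e).
Proof. exact: in_set2. Qed.

Lemma ends_subset e A : (ends e \subset A) = (etail e \in A) && (ehead e \in A).
Proof. by rewrite subUset !sub1set. Qed.

Lemma ends_dart d : ends d.1 = [set source d; target d].
Proof. by case: d => e []; rewrite /target /source //= setUC. Qed.

Lemma adjacent_sym A F : symmetric (adjacent A F).
Proof. by move=> u v; apply: eq_existsb => e; rewrite [[set v; u]]setUC. Qed.

Lemma connect_adjacent_sym A F : connect_sym (adjacent A F).
Proof. exact/sym_connect_sym/adjacent_sym. Qed.

Lemma adjacent_dart A F x y : adjacent A F x y ->
  exists d, [/\ source d = x, target d = y, d.1 \in F & ends d.1 \subset A].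
Proof.
case/exists_inP => e eF /andP[eA /eqP Ee].
have := loopless e; have : x \in ends e by rewrite Ee set21.
have : y \in ends e by rewrite Ee set22.
have : ehead e \in [set x; y] by rewrite -Ee set22.
have : etail e \in [set x; y] by rewrite -Ee set21.
rewrite !inE => /orP[]/eqP Et /orP[]/eqP Eh _ _; rewrite Et Eh ?eqxx // => _.
- by exists (e, false); split.
- by exists (e, true); split.
Qed.

Lemma adjacent_edge A F e : e \in F -> ends e \subset A -> adjacent A F (etail e) (ehead e).
Proof. by move=> eF eA; apply/exists_inP; exists e; rewrite // eA eqxx. Qed.

(** Lifts a simple vertex path to darts. The clause on [c] allows a closing dart to be put in front.
    No edge recurs, since its first source [x] would then be met again on the path. *)
Lemma path_adjacent_darts A F x p : path (adjacent A F) x p -> uniq (x :: p) ->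
  exists q : seq (dart G),
    [/\ map (@source G) q = belast x p, map (@target G) q = p,
        forall c, target c = x -> path [rel x y | target x == source y] c q,
        uniq [seq d.1 | d <- q]
      & all (fun d => (d.1 \in F) && (ends d.1 \subset A)) q].
Proof.
elim: p x => [|y p IH] x /=; first by move=> _ _; exists [::]; split.
move=> /andP[/adjacent_dart[d [dx dy dF dA]] /IH{}IH] /andP[xyp uyp].
have [q [qs qt qp qu qF]] := IH uyp; exists (d :: q); split=> /=.
- by rewrite dx qs.
- by rewrite dy qt.
- by move=> c cx; rewrite cx dx eqxx qp.
- rewrite qu andbT; apply: contra xyp => /mapP[d' d'q Ed].
  have : x \in ends d'.1 by rewrite -Ed ends_dart dx set21.
  rewrite ends_dart in_set2 => /orP[]/eqP ->.
    by apply: mem_belast; rewrite -qs map_f.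
  by rewrite in_cons -qt map_f ?orbT.
- by rewrite dF dA.
Qed.

(** A simple path from head to tail avoiding [e] would be closed into a cycle by [e]. *)
Lemma acyclic_bridge A F e : acyclic A F -> e \in F -> ends e \subset A ->
  ~~ connect (adjacent A (F :\ e)) (ehead e) (etail e).
Proof.
move=> acyc eF eA; apply/negP => /connectP[p0 /shortenP[p pP pU _] Ep].
have [q [qs qt qp qu /allP qF]] := path_adjacent_darts pP pU.
pose e0 : dart G := (e, false).
have/negP[] : ~~ all (fun d => (d.1 \in F) && (ends d.1 \subset A)) (e0 :: q).
  apply: acyc; rewrite /is_cycle /= qu andbT; apply/and3P; split.
  - rewrite rcons_path qp //= -(last_map (@target G)) qt.
    by rewrite -[target e0]/(ehead e) -Ep.
  - by rewrite qs -[source e0]/(etail e) Ep -rcons_uniq -lastI.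
  - by apply/negP => /mapP[d /qF] /[swap] /= <-; rewrite !inE eqxx.
rewrite /= eF eA /=; apply/allP => d /qF; rewrite inE.
by case/andP => /andP[_ ->] ->.
Qed.

Lemma acyclicW A C F : C \subset A -> acyclic A F -> acyclic C F.
Proof.
move=> CA acyc p /acyc; apply: contra => /allP pC.
by apply/allP => d /pC /andP[-> /subset_trans->].
Qed.

Lemma card_forest A F : acyclic A F -> A != set0 ->
  #|[set e in F | ends e \subset A]| < #|A|.
Proof.
have [n] := ubnP #|A|; elim: n A => // n IH A ltAn acyc A0.
have [->|[e]] := set_0Vmem [set e in F | ends e \subset A].
  by rewrite cards0 card_gt0.
rewrite inE => /andP[eF eA].
have bridge := acyclic_bridge acyc eF eA.
move: (eA); rewrite ends_subset => /andP[tA hA].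
pose con := connect (adjacent A (F :\ e)).
(* Since [e] is a bridge, it separates [A] into the part [C] reachable from its head without [e] and
   the rest [D]; every other edge inside [A] stays inside [C] or [D]. *)
pose C := [set x in A | con (ehead e) x]; pose D := A :\: C.
have CA : C \subset A by apply/subsetP => x; rewrite inE => /andP[].
have DA : D \subset A by apply: subsetDl.
have hC : ehead e \in C by rewrite inE hA /con connect0.
have tD : etail e \in D by rewrite !inE tA /con (negPf bridge).
have cardA : #|A| = #|C| + #|D| by rewrite cardsD (setIidPr CA) subnKC // subset_leq_card.
have C_gt0 : 0 < #|C| by rewrite card_gt0; apply/set0Pn; exists (ehead e).
have D_gt0 : 0 < #|D| by rewrite card_gt0; apply/set0Pn; exists (etail e).
have IHC : #|[set e in F | ends e \subset C]| < #|C|.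
  by apply: IH; [lia | exact: acyclicW acyc | rewrite -card_gt0].
have IHD : #|[set e in F | ends e \subset D]| < #|D|.
  by apply: IH; [lia | exact: acyclicW acyc | rewrite -card_gt0].
have sub : [set e in F | ends e \subset A] \subset
    e |: ([set e in F | ends e \subset C] :|: [set e in F | ends e \subset D]).
  apply/subsetP => f; rewrite !inE => /andP[fF fA]; rewrite fF /=.
  have [//|fe] := eqVneq f e; rewrite !ends_subset.
  have : adjacent A (F :\ e) (etail f) (ehead f).
    by apply: adjacent_edge; rewrite // !inE fe.
  move: fA; rewrite ends_subset => /andP[ftA fhA] /connect1 cf.
  rewrite !inE ftA fhA /= !andbT.
  have -> : con (ehead e) (etail f) = con (ehead e) (ehead f).
    by apply: (same_connect_r (@connect_adjacent_sym _ _) cf).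
  by case: (con _ _).
apply: leq_ltn_trans (subset_leq_card sub) _.
rewrite cardsU1 cardsU; lia.
Qed.

End Forests.

(** * Cuts, components and degree sums *)

Section Counting.

Variable G : multigraph.
Implicit Types (T X : {set vertex G}) (B F : {set edge G}) (e : edge G) (v : vertex G).

Lemma boundaryC X : boundary (~: X) = boundary X.
Proof. by apply/setP => e; rewrite !inE; do 2!case: (_ \in X). Qed.

Lemma boundary_neq0 X : connected [set: vertex G] [set: edge G] ->
  X != set0 -> ~: X != set0 -> boundary X != set0.
Proof.
move=> [_ conn] /set0Pn[x xX] /set0Pn[y]; rewrite inE => yX.
apply: contraNneq yX => bX0.
have clX : closed (adjacent setT setT) (mem X).
  move=> _ _ /adjacent_dart[[e b] [<- <- _ _]].
  have : e \notin boundary X by rewrite bX0 inE.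
  by rewrite inE negbK /target /source /=; case: b => /eqP ->.
by rewrite -(closed_connect clX (conn x y _ _)).
Qed.

Lemma component_neq0 F T : T \in components F -> T != set0.
Proof.
case/imsetP => x _ ->; apply/set0Pn; exists x.
by rewrite !inE connect0.
Qed.

Lemma boundary_component F T : T \in components F -> boundary T \subset ~: F.
Proof.
case/imsetP => x _ ->; apply/subsetP => e; rewrite !inE /=; apply: contra => eF.
apply/eqP; apply: same_connect_r; first exact: connect_adjacent_sym.
by apply/connect1/adjacent_edge; rewrite ?subsetT.
Qed.

Lemma components_disjoint F T1 T2 :
  T1 \in components F -> T2 \in components F -> T1 != T2 -> [disjoint T1 & T2].
Proof.
case/imsetP => x _ -> /imsetP[y _ ->]; apply: contraR.
case/pred0Pn => z /andP[]; rewrite !inE /= => xz yz; apply/eqP/setP => w; rewrite !inE /=.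
have sym := @connect_adjacent_sym G setT F.
by rewrite (same_connect sym xz) (same_connect sym yz).
Qed.

(** The boundary of a component is a non-empty cut inside [B], hence equals [B] by minimality. Edges
    leaving [T1] are then those leaving [T2], so the union has empty boundary and is everything by
    connectedness. *)
Lemma end_trees_bond B T1 T2 : connected [set: vertex G] [set: edge G] ->
  is_bond B -> end_trees B T1 T2 -> T2 = ~: T1 /\ boundary T1 = B.
Proof.
move=> conn /minsetP[/andP[_ cutB] minB] [T1c T2c neqT].
have disj := components_disjoint T1c T2c neqT.
have T1n0 := component_neq0 T1c; have T2n0 := component_neq0 T2c.
have bd T T' : T \in components (~: B) -> T != set0 -> T' != set0 -> [disjoint T & T'] ->
    boundary T = B.
  move=> Tc Tn0 T'n0 dTT'; apply: minB; last by have := boundary_component Tc; rewrite setCK.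
  apply/andP; split; last by apply/existsP; exists T.
  apply: boundary_neq0 => //; apply: contraNneq T'n0 => TC0.
  by rewrite -subset0 -TC0 -disjoints_subset disjoint_sym.
have b1 := bd _ _ T1c T1n0 T2n0 disj.
have b2 : boundary T2 = B by apply: (bd _ T1); rewrite // disjoint_sym.
split=> //; apply/eqP; rewrite eqEsubset -disjoints_subset disjoint_sym disj /=.
have U0 : boundary (T1 :|: T2) = set0.
  apply/setP => e; have : (e \in boundary T1) = (e \in boundary T2) by rewrite b1 b2.
  have nin x : ~~ ((x \in T1) && (x \in T2)).
    by apply/negP => /andP[xT1]; apply/negP; rewrite (disjointFr disj xT1).
  have := nin (etail e); have := nin (ehead e); rewrite !inE.
  by do 4!case: (_ \in _).
have : ~~ (~: (T1 :|: T2) != set0).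
  apply/negP => C0; suff : boundary (T1 :|: T2) != set0 by rewrite U0 eqxx.
  apply: boundary_neq0 => //; case/set0Pn: T1n0 => x xT1; apply/set0Pn; exists x.
  by rewrite inE xT1.
by rewrite negbK setCU -setDE setD_eq0.
Qed.

Lemma card_source v : #|[set d : dart G | source d == v]| = degree v.
Proof.
rewrite /degree -(card_in_imset (f := fst)) => [|[e b] [e' b']]; last first.
  rewrite !inE /= => /eqP sv /eqP sv' ee'; rewrite -ee' in sv' *.
  move: (loopless e) sv sv'; case: b b' => [] [] //=; rewrite /source /= => /eqP neq sv sv'.
    by case: neq; rewrite sv sv'.
  by case: neq; rewrite sv sv'.
apply: eq_card => e; apply/imsetP/idP => [[d] | ].
  by rewrite !inE => /eqP <- ->; rewrite -in_set2 -/(ends d.1) ends_dart set21.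
rewrite inE in_ends => /orP[]/eqP ->.
  by exists (e, false); rewrite // inE.
by exists (e, true); rewrite // inE.
Qed.

Lemma card_sum_mem (I : finType) (A : {set I}) : #|A| = \sum_i (i \in A).
Proof. by rewrite -sum1_card big_mkcond; apply: eq_bigr => i _; case: (i \in A). Qed.

Lemma degreeE v : degree v = \sum_e ((etail e == v) + (ehead e == v)).
Proof.
rewrite /degree -sum1_card big_mkcond; apply: eq_bigr => e _.
rewrite inE in_ends ![v == _]eq_sym.
have [<-|_] := eqVneq (etail e) v; last by case: eqP.
by rewrite eq_sym (negPf (loopless e)).
Qed.

Lemma sum_degree T :
  \sum_(v in T) degree v = 2 * #|[set e | ends e \subset T]| + #|boundary T|.
Proof.
have sum_eq x : \sum_(v in T) (x == v) = (x \in T).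
  rewrite big_mkcond /= (bigD1 x) //= eqxx big1 ?addn0 => [|v /negPf]; first by case: (x \in T).
  by rewrite eq_sym => ->; case: ifP.
under eq_bigr => v _ do rewrite degreeE.
rewrite exchange_big /=; under eq_bigr => e _ do rewrite big_split !sum_eq /=.
rewrite !card_sum_mem big_distrr -big_split; apply: eq_bigr => e _ /=.
by rewrite !inE ends_subset; do 2!case: (_ \in T).
Qed.

Lemma card_edges T : #|edge G| =
  #|[set e | ends e \subset T]| + #|[set e | ends e \subset ~: T]| + #|boundary T|.
Proof.
rewrite !card_sum_mem -sum1_card -!big_split; apply: eq_bigr => e _ /=.
by rewrite !inE !ends_subset !inE; do 2!case: (_ \in T).
Qed.

Lemma edges_inside T : [set e in ~: boundary T | ends e \subset T] = [set e | ends e \subset T].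
Proof. by apply/setP => e; rewrite !inE ends_subset; do 2!case: (_ \in T). Qed.

End Counting.

(** * Darts and facial triangles of the map *)

Section PlaneGraphs.

Variable G : plane_graph.
Implicit Types (d : dart G) (T : {set vertex G}).

Local Notation r := (rotation G).

Lemma rev_dartK : involutive (@rev_dart G).
Proof. by case=> e b; rewrite /rev_dart /= negbK. Qed.

Definition rev_perm : {perm dart G} := perm (inv_inj rev_dartK).

Lemma card_dart : #|{: dart G}| = 2 * #|edge G|.
Proof. by rewrite card_prod card_bool mulnC. Qed.

Lemma source_rotation d : source (r d) = source d.
Proof. by apply/eqP; rewrite eq_sym -rotation_orbit fconnect1. Qed.

Lemma source_face d : source (face d) = target d.
Proof. exact: source_rotation. Qed.

Lemma order_rotation d : fingraph.order r d = degree (source d).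
Proof.
rewrite -card_source /fingraph.order; apply: eq_card => d'.
by rewrite !inE -[LHS]/(fconnect r d d') rotation_orbit eq_sym.
Qed.

Lemma iter_rotation d : iter (degree (source d)) r d = d.
Proof. by rewrite -order_rotation iter_order //; apply: perm_inj. Qed.

Lemma face_inj : injective (@face G).
Proof. by move=> d d' /perm_inj /(inv_inj rev_dartK). Qed.

(** Rotation reaches all darts at a vertex and reversal passes to a neighbour, so following a vertex
    path reaches every dart. *)
Lemma rotation_rev_transitive (d0 : dart G) :
  [transitive <<[set r; rev_perm]>>%g, on [set: dart G] | 'P].
Proof.
apply/imsetP; exists d0 => //; apply/eqP; rewrite eqEsubset subsetT andbT.
apply/subsetP => d _; set O := orbit _ _ _.
have step g x : g \in [set r; rev_perm] -> x \in O -> g x \in O.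
  move=> gG /orbitP[h hG <-]; rewrite -[g _]/('P%act _ g) -actM.
  by apply: mem_orbit; rewrite groupM // mem_gen.
have stepr x y : source x = source y -> x \in O -> y \in O.
  move/eqP; rewrite -rotation_orbit => /connectP[p + ->].
  elim: p x => [|z p IH] x //= /andP[/eqP <- pP] xO; apply: IH pP _.
  by apply: step; rewrite // set21.
have steprev x : x \in O -> rev_dart x \in O.
  by move=> xO; rewrite -[rev_dart x](permE (inv_inj rev_dartK)); apply: step; rewrite // set22.
have /connectP[p] := (plane_connected G).2 (source d0) (source d) (in_setT _) (in_setT _).
have : d0 \in O by apply: orbit_refl.
elim: p {1 2 3}d0 => [|v p IH] x xO /=; first by move=> _ /esym sx; apply: stepr xO.
case/andP => /adjacent_dart[y [yx yv _ _]]; rewrite -yv -[target y]/(source (rev_dart y)).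
by apply: IH; apply/steprev/(stepr x).
Qed.

Lemma iter_face (tri : triangulation G) d : iter 3 (@face G) d = d.
Proof. by have [_ <-] := tri d; rewrite size_orbit iter_order //; apply: face_inj. Qed.

Lemma card_faces : triangulation G -> 3 * fcard (@face G) predT = 2 * #|edge G|.
Proof.
move=> tri; rewrite -card_dart mulnC; apply: fcard_order_set => //.
- exact: face_inj.
- by apply/subsetP => d _; rewrite inE -size_orbit; have [_ ->] := tri d.
Qed.

Lemma dvdn4_card_dart : triangulation G ->
    (forall v : vertex G, degree v = 3 \/ degree v = 6) -> (exists v : vertex G, degree v = 3) ->
  4 %| #|{: dart G}|.
Proof.
move=> tri deg36 [v dv].
have [d dvE] : exists d, source d = v.
  have : 0 < #|[set d : dart G | source d == v]| by rewrite card_source dv.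
  by case/card_gt0P => d; rewrite inE => /eqP; exists d.
apply: (@dvdn4_card_transitive _ r rev_perm _ _ _ _ 'P%act d).
- apply/permP => x; rewrite permX perm1.
  by have := iter_rotation x; case: (deg36 (source x)) => -> E //; rewrite (iterD 3 3) !E.
- by apply/permP => x; rewrite permX perm1 /= !permE rev_dartK.
(* Permutation products apply the left factor first, so [rev_perm * r] is [face], of order dividing
   3 on triangles. *)
- apply/permP => x; rewrite permX perm1 -[RHS](iter_face tri).
  by rewrite /= !permM !permE.
- exact: rotation_rev_transitive d.
- by rewrite /= apermE permX -dv -dvE iter_rotation.
- by move=> [e b]; rewrite /= apermE permE xpair_eqE eqxx; case: b.
Qed.

Lemma card_bond T : triangulation G -> acyclic T [set: edge G] ->
  acyclic (~: T) [set: edge G] -> 3 * #|boundary T| = 2 * #|edge G|.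
Proof.
move=> tri acT acC; pose b d : nat := d.1 \in boundary T.
have bE d : b d = ((source d \in T) != (source (face d) \in T)).
  rewrite source_face /b inE; case: d => e []; rewrite /source /target //= /source /=.
  by rewrite eq_sym.
(* A closed walk changes sides an even number of times; zero changes would put the triangle inside
   one of two acyclic parts. *)
have face2 d : b d + b (face d) + b (face (face d)) = 2.
  have f3 := iter_face tri d; rewrite /= in f3.
  have [cyc siz] := tri d.
  have orbE : fingraph.orbit (@face G) d = [:: d; face d; face (face d)].
    by rewrite /fingraph.orbit -size_orbit siz.
  have alls X : acyclic X [set: edge G] ->
     ~~ [&& source d \in X, source (face d) \in X & source (face (face d)) \in X].
    move=> acX; apply: contra (acX _ cyc) => /and3P[d0 d1 d2].
    by rewrite orbE /= !ends_dart -!source_face f3 !subUset !sub1set !inE d0 d1 d2.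
  have := alls _ acC; have := alls _ acT; rewrite !bE f3 !inE.
  by do 3!case: (_ \in T).
have sum_b : \sum_d b d = 2 * #|boundary T|.
  rewrite -[2]card_bool mulnC -cardsT -cardsX card_sum_mem; apply: eq_bigr => -[e c] _.
  by rewrite !inE andbT /b inE.
(* Summing over darts instead of faces counts each triangle three times; as [face] is a bijection,
   each of the three summands totals [2 * #|boundary T|]. *)
have : \sum_d (b d + b (face d) + b (face (face d))) = \sum_(d : dart G) 2.
  by apply: eq_bigr => d _; apply: face2.
rewrite !big_split /= -(reindex_inj (h := @face G) (P := predT)) ?sum_b; last exact: face_inj.
rewrite -(reindex_inj (h := @face G \o @face G) (P := predT) (F := b)) ?sum_b; last first.
  by apply: inj_comp; apply: face_inj.
rewrite sum_nat_const card_dart; move: #|boundary T| #|edge G|; lia.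
Qed.

End PlaneGraphs.

(** * Comparison of the vertex counts in the two end-trees *)

Theorem theorem5p1 (G : plane_graph) (hG : in_P G) (B : {set edge G})
    (hB : hamilton_bond B) (T1 T2 : {set vertex G}) (hT : end_trees B T1 T2) :
  #|[set v in T1 | degree v == 6]| = #|[set v in T2 | degree v == 6]| /\
  #|[set v in T1 | degree v == 3]| = #|[set v in T2 | degree v == 3]|.
Proof.
have [_ tri deg36] := hG; have [bondB trees] := hB; have [T1c T2c _] := hT.
have [T2E BE] := end_trees_bond (plane_connected G) bondB hT.
(* An edge with both ends in [T] is not in [boundary T = B], so acyclicity without [B] is acyclicity
   of the induced subgraph. *)
have forest T : T \in components (~: B) -> boundary T = B ->
    acyclic T [set: edge G] /\ #|[set e | ends e \subset T]| < #|T|.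
  move=> Tc bT; have [_ acT] := trees T Tc; split.
    move=> p /acT; apply: contra => /allP pT; apply/allP => d /pT /andP[_ dT].
    rewrite dT -bT !inE negbK andbT; move: dT; rewrite ends_subset => /andP[-> ->] //.
  by rewrite -edges_inside bT; apply: card_forest => //; apply: component_neq0 Tc.
have [acT1 F1] := forest T1 T1c BE.
have bT2 : boundary T2 = B by rewrite T2E boundaryC.
have [acT2 F2] := forest T2 T2c bT2.
have cardB := card_bond tri acT1; rewrite -T2E BE in cardB; have {}cardB := cardB acT2.
have cardF := card_faces tri.
have cardE := card_edges T1; rewrite -T2E BE in cardE.
have euler := plane_euler G; rewrite -[fcard _ _]/(fcard (@face G) predT) in euler.
have cardV := cardsC T1; rewrite -T2E in cardV.
have split_deg (T : {set vertex G}) :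
    #|T| = #|[set v in T | degree v == 3]| + #|[set v in T | degree v == 6]| /\
    \sum_(v in T) degree v =
       3 * #|[set v in T | degree v == 3]| + 6 * #|[set v in T | degree v == 6]|.
  split; rewrite !card_sum_mem.
    rewrite -big_split; apply: eq_bigr => v _; rewrite !inE.
    by case: (deg36 v) => ->; case: (v \in T).
  rewrite big_distrr [6 * _]big_distrr -big_split big_mkcond; apply: eq_bigr => v _ /=.
  by rewrite !inE; case: (deg36 v) => ->; case: (v \in T).
have [n1 d1] := split_deg T1; have [n2 d2] := split_deg T2.
rewrite sum_degree BE in d1; rewrite sum_degree bT2 in d2.
have d4 : 4 %| #|{: dart G}|.
  apply: dvdn4_card_dart => //.
  (* Euler's formula with [3 * F = 2 * E] and the degree sum [2 * E] gives exactly four vertices of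
     degree 3. *)
  have : 0 < #|[set v in T1 | degree v == 3]| + #|[set v in T2 | degree v == 3]|.
    lia.
  by rewrite addn_gt0 => /orP[] /card_gt0P[v]; rewrite inE => /andP[_ /eqP]; exists v.
(* By Euler's formula the forest bounds F1 and F2 must be equalities. *)
rewrite card_dart in d4; move: cardB cardF cardE euler cardV n1 d1 n2 d2 d4 F1 F2.
lia.
Qed.
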